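(* Let $\lambda$ be a nonzero complex number. For every integer $n\geq 0$, $$C_{n,\lambda}^* = \sum_{m=0}^n \binom{n}{m}\lambda^{n-m}\, D_{n-m}\, C_{m,\lambda},$$ where $C_{n,\lambda}^*$ are the degenerate Cauchy numbers, $D_n$ are the Daehee numbers, and $C_{m,\lambda}$ are the degenerate Cauchy numbers of the second kind.
   Context: All generating functions are formal power series in $t$, with $\log(1+u)=\sum_{k\ge 1}\frac{(-1)^{k-1}}{k}u^k$. The degenerate Cauchy numbers of the second kind $C_{n,\lambda}$ are defined by $$\frac{t}{\log\left(1+\frac{1}{\lambda}\log(1+\lambda t)\right)}=\sum_{n=0}^\infty C_{n,\lambda}\frac{t^n}{n!}.$$ The degenerate Cauchy numbers $C_{n,\lambda}^*$ are defined by $$\frac{\frac{1}{\lambda}\log(1+\lambda t)}{\log\left(1+\frac{1}{\lambda}\log(1+\lambda t)\right)}=\sum_{n=0}^\infty C_{n,\lambda}^*\frac{t^n}{n!}.$$ The Daehee numbers $D_n$ are defined by $$\frac{\log(1+t)}{t}=\sum_{n=0}^\infty D_n\frac{t^n}{n!}.$$ *)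

(* Defs.v *)
From mathcomp Require Import all_boot all_order all_algebra complex.
From mathcomp Require Import all_classical all_reals.

Set Implicit Arguments.
Unset Strict Implicit.
Unset Printing Implicit Defensive.
Import Order.TTheory GRing.Theory Num.Theory.
Local Open Scope ring_scope.

(* A formal power series over K in one variable t is the sequence of its
   coefficients: [f n] is the coefficient of t^n. *)
Definition fps (K : Type) : Type := nat -> K.

Section FormalPowerSeries.
Variable K : fieldType.
Implicit Types (f g u : fps K) (c : K).

Definition fps_zero : fps K := fun _ => 0.
Definition fps_one : fps K := fun n => (n == 0%N)%:R.
Definition fps_X : fps K := fun n => (n == 1%N)%:R.

Definition fps_scale c f : fps K := fun n => c * f n.
Definition fps_mul f g : fps K := fun n => \sum_(i < n.+1) f i * g (n - i)%N.
Definition fps_exp f k : fps K := iter k (fps_mul f) fps_one.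

(* The quotient f / g is the series q such that q * g = f. As K[[t]] is an
   integral domain, q is unique when g is nonzero; if there is no such q, the
   value is the junk value 0. No condition is put on the
   constant term of g: both series may have positive order, as in log(1 + t) / t. *)
Definition fps_div f g : fps K :=
  xget fps_zero [set q : fps K | fps_mul q g = f]%classic.

(* log(1 + u) = \sum_(k >= 1) (-1)^(k-1) / k * u^k, meaningful for a series u
   without constant term. Then u^k has no term of degree < k, so that the terms
   with k > n do not contribute to the coefficient of t^n and the sum can be
   cut at k = n. *)
Definition fps_log1p u : fps K := fun n =>
  \sum_(1 <= k < n.+1) (-1) ^+ k.-1 / k%:R * fps_exp u k n.

(* The sequence a such that f = \sum_n a n * t^n / n!. *)
Definition egf_coef f (n : nat) : K := n`!%:R * f n.

(* (1 / lambda) * log(1 + lambda * t) *)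
Definition deg_log (lambda : K) : fps K :=
  fps_scale lambda^-1 (fps_log1p (fps_scale lambda fps_X)).

(* C_{n, lambda} *)
Definition deg_cauchy_snd (lambda : K) : nat -> K :=
  egf_coef (fps_div fps_X (fps_log1p (deg_log lambda))).

(* C^*_{n, lambda} *)
Definition deg_cauchy (lambda : K) : nat -> K :=
  egf_coef (fps_div (deg_log lambda) (fps_log1p (deg_log lambda))).

Definition daehee : nat -> K :=
  egf_coef (fps_div (fps_log1p fps_X) fps_X).

End FormalPowerSeries.

Arguments daehee : clear implicits.

(* Main.v *)
Require Import Defs.
From mathcomp Require Import all_boot all_order all_algebra complex.
From mathcomp Require Import all_classical all_reals.
Import Order.TTheory GRing.Theory Num.Theory.
Local Open Scope ring_scope.

(** Put L = log(1 + lambda t) / lambda and G = log(1 + L), and let D(t) and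
A(t) be the series log(1 + t) / t and t / G. Substituting lambda t for t gives
L = t D(lambda t), hence L / G = D(lambda t) A(t), and the theorem compares
coefficients. The quotients exist and are unique because G = t + O(t^2). *)

Section FormalPowerSeriesTheory.
Variable K : fieldType.
Implicit Types (f g h q : fps K) (c : K).

(** The coefficient of [t^n] in a product involves only coefficients up to [n], so ring laws for
    series can be read off from polynomial truncations. *)
Lemma fps_mul_poly {f g} {p q : {poly K}} {n : nat} :
  (forall i, (i <= n)%N -> f i = p`_i) ->
  (forall i, (i <= n)%N -> g i = q`_i) ->
  fps_mul f g n = (p * q)`_n.
Proof.
move=> fp gq; rewrite coefM; apply: eq_bigr => i _.
by rewrite fp ?gq ?leq_subr // -ltnS.
Qed.

Lemma fps_trunc f (n i : nat) :
  (i <= n)%N -> f i = (\poly_(j < n.+1) f j)`_i.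
Proof. by move=> le_in; rewrite coef_poly ltnS le_in. Qed.

Lemma fps_mulC f g : fps_mul f g = fps_mul g f.
Proof.
apply: funext => n.
rewrite (fps_mul_poly (fps_trunc f n) (fps_trunc g n)) mulrC.
by rewrite -(fps_mul_poly (fps_trunc g n) (fps_trunc f n)).
Qed.

Lemma fps_mulA f g h : fps_mul f (fps_mul g h) = fps_mul (fps_mul f g) h.
Proof.
apply: funext => n.
pose T f := \poly_(j < n.+1) f j.
have TE f1 i : (i <= n)%N -> f1 i = (T f1)`_i by exact: fps_trunc.
have TM f1 f2 i : (i <= n)%N -> fps_mul f1 f2 i = (T f1 * T f2)`_i.
  by move=> le_in; apply: fps_mul_poly => j le_ji; apply: TE (leq_trans le_ji le_in).
by rewrite (fps_mul_poly (TE f) (TM g h)) (fps_mul_poly (TM f g) (TE h)) mulrA.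
Qed.

Lemma fps_mul1 f : fps_mul f (fps_one K) = f.
Proof.
apply: funext => n; rewrite /fps_mul big_ord_recr /= subnn mulr1 big1 ?add0r //.
by move=> i _; rewrite /fps_one subn_eq0 leqNgt ltn_ord mulr0.
Qed.

Lemma fps_mulX0 f : fps_mul f (fps_X K) 0 = 0.
Proof. by rewrite /fps_mul big_ord1 mulr0. Qed.

Lemma fps_mulXS f n : fps_mul f (fps_X K) n.+1 = f n.
Proof.
rewrite /fps_mul 2!big_ord_recr /= subnn subSnn mulr0 mulr1 addr0 big1 ?add0r //.
move=> i _; rewrite /fps_X subSn ?(ltnW (ltn_ord i)) // eqSS subn_eq0.
by rewrite leqNgt ltn_ord mulr0.
Qed.

Lemma fps_mulX_inj : injective (fun f => fps_mul f (fps_X K)).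
Proof.
move=> f g eq_fg; apply: funext => n.
by rewrite -(fps_mulXS f) -(fps_mulXS g) [LHS](congr1 (fun s : fps K => s n.+1) eq_fg).
Qed.

Lemma fps_mulX_shift f : f 0 = 0 -> fps_mul (f \o succn) (fps_X K) = f.
Proof. by move=> f0; apply: funext => -[|n]; rewrite ?fps_mulX0 ?fps_mulXS. Qed.

(** First [n] coefficients of [1 / f]. A list is carried along because each new coefficient is
    solved from all the earlier ones. *)
Fixpoint fps_inv_coefs f n : seq K :=
  if n is m.+1 then
    let s := fps_inv_coefs f m in
    rcons s (((m == 0%N)%:R - \sum_(i < m) s`_i * f (m - i)%N) / f 0%N)
  else [::].

Lemma size_fps_inv_coefs f n : size (fps_inv_coefs f n) = n.
Proof. by elim: n => //= n IHn; rewrite size_rcons IHn. Qed.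

Lemma nth_fps_inv_coefs f n i :
  (i < n)%N -> (fps_inv_coefs f n)`_i = (fps_inv_coefs f i.+1)`_i.
Proof.
elim: n => // n IHn; rewrite ltnS leq_eqVlt => /predU1P[-> //|lt_in].
by rewrite [in LHS]/= nth_rcons size_fps_inv_coefs lt_in IHn.
Qed.

Lemma fps_unit f : f 0 != 0 -> exists g, fps_mul g f = fps_one K.
Proof.
move=> f0; exists (fun n => (fps_inv_coefs f n.+1)`_n).
apply: funext => n; rewrite /fps_mul big_ord_recr /= subnn.
rewrite nth_rcons size_fps_inv_coefs ltnn eqxx divfK // addrC.
rewrite [X in _ + X](_ : _ = \sum_(i < n) (fps_inv_coefs f n)`_i * f (n - i)%N) ?subrK //.
by apply: eq_bigr => i _; rewrite (nth_fps_inv_coefs f n).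
Qed.

(** The witness [q] excludes the junk value, and uniqueness identifies the chosen quotient with
    [q]. *)
Lemma fps_divE f g q :
  (forall q', fps_mul q' g = f -> q' = q) -> fps_mul q g = f -> fps_div f g = q.
Proof.
by move=> uniq_q qg; apply: uniq_q; exact: (@xgetI _ _ [set q | fps_mul q g = f]%classic q qg).
Qed.

Lemma fps_divX f : f 0 = 0 -> fps_div f (fps_X K) = f \o succn.
Proof.
move=> f0; apply: fps_divE; last exact: fps_mulX_shift.
by move=> q qX; apply: fps_mulX_inj; rewrite qX fps_mulX_shift.
Qed.

(** Here [g] is [t] times a unit, so [t / g] is the inverse [a] of that unit, and [f * a] is the
    other quotient. *)
Lemma fps_mul_div f g h : g 0 = 0 -> g 1 != 0 ->
  fps_div (fps_mul f (fps_X K)) g = fps_mul f (fps_div (fps_X K) g).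
Proof.
move=> g0 /(fps_unit (g \o succn))[a ag].
have {}ag : fps_mul a g = fps_X K.
  by rewrite -(fps_mulX_shift g) // fps_mulA ag fps_mulC fps_mul1.
(* Multiplying further by [a] turns the factor [g] into [t], which cancels. *)
have inj_g : injective (fun q => fps_mul q g).
  move=> q q' eq_q; apply: fps_mulX_inj.
  by rewrite -ag (fps_mulC a) !fps_mulA eq_q.
have -> : fps_div (fps_X K) g = a.
  by apply: fps_divE => // q qg; apply: inj_g; rewrite qg.
have fag : fps_mul (fps_mul f a) g = fps_mul f (fps_X K) by rewrite -fps_mulA ag.
by apply: fps_divE => // q qg; apply: inj_g; rewrite qg.
Qed.

(** The substitution of [c * t] for [t], which is multiplicative and therefore commutes with powers
    and with [fps_log1p]. *)
Definition fps_dilate c f : fps K := fun n => c ^+ n * f n.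

Lemma fps_dilateM c f g :
  fps_dilate c (fps_mul f g) = fps_mul (fps_dilate c f) (fps_dilate c g).
Proof.
apply: funext => n; rewrite /fps_dilate /fps_mul mulr_sumr.
apply: eq_bigr => i _; rewrite mulrACA -exprD subnKC //.
by rewrite -ltnS.
Qed.

Lemma fps_dilate_exp c f k : fps_dilate c (fps_exp f k) = fps_exp (fps_dilate c f) k.
Proof.
elim: k => [|k IHk]; last first.
  by rewrite -[fps_exp f _]/(fps_mul f (fps_exp f k)) fps_dilateM IHk.
by apply: funext => -[|n]; rewrite /fps_dilate ?mul1r ?mulr0.
Qed.

Lemma fps_dilate_log1p c f : fps_dilate c (fps_log1p f) = fps_log1p (fps_dilate c f).
Proof.
apply: funext => n; rewrite /fps_dilate /fps_log1p mulr_sumr.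
by apply: eq_bigr => k _; rewrite mulrCA -fps_dilate_exp.
Qed.

Lemma fps_dilateX c : fps_dilate c (fps_X K) = fps_scale c (fps_X K).
Proof. by apply: funext => -[|[|n]]; rewrite /fps_dilate /fps_scale ?mulr0. Qed.

Lemma fps_log1p0 f : fps_log1p f 0 = 0.
Proof. by rewrite /fps_log1p big_geq. Qed.

(** Only the term [k = 1] survives the cut. Used twice, this gives [log(1 + L)] the linear
    coefficient 1. *)
Lemma fps_log1p1 f : fps_log1p f 1 = f 1.
Proof. by rewrite /fps_log1p big_nat1 /= divr1 mul1r /fps_exp /= fps_mul1. Qed.

Lemma deg_logE c : c != 0 ->
  deg_log c =
  fps_mul (fps_dilate c (fps_div (fps_log1p (fps_X K)) (fps_X K))) (fps_X K).
Proof.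
move=> c0; rewrite fps_divX ?fps_log1p0 // /deg_log -fps_dilateX -fps_dilate_log1p.
apply: funext => -[|n]; rewrite ?fps_mulX0 ?fps_mulXS /fps_scale /fps_dilate.
  by rewrite fps_log1p0 !mulr0.
(* The shift by [t] leaves one extra factor [c], which cancels the prefactor [c^-1]. *)
by rewrite exprS -mulrA mulKf.
Qed.

Lemma deg_log1 c : c != 0 -> deg_log c 1 = 1.
Proof.
by move=> c0; rewrite /deg_log /fps_scale fps_log1p1 mulr1 mulVf.
Qed.

Lemma deg_cauchyE c n : c != 0 ->
  deg_cauchy c n =
  \sum_(0 <= m < n.+1)
     'C(n, m)%:R * c ^+ (n - m) * daehee K (n - m) * deg_cauchy_snd c m.
Proof.
move=> c0; set G := fps_log1p (deg_log c).
have G1 : G 1%N != 0 by rewrite /G fps_log1p1 deg_log1 ?oner_neq0.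
(* Only the numerator is factored. The final swap makes the summation index [m] run over the
   coefficients of [t / G]. *)
rewrite /deg_cauchy {1}deg_logE // fps_mul_div ?fps_log1p0 // fps_mulC.
rewrite /egf_coef /fps_mul mulr_sumr big_mkord; apply: eq_bigr => m _.
rewrite /daehee /deg_cauchy_snd /egf_coef /fps_dilate -/G.
have le_mn : (m <= n)%N by rewrite -ltnS.
(* Splitting [n!] as ['C(n, m) * (m! * (n - m)!)] gives each series its own factorial. *)
rewrite -(bin_fact le_mn) !natrM -!mulrA; congr (_ * _).
rewrite mulrC [RHS]mulrC -!mulrA; congr (_ * _).
by rewrite [RHS]mulrA [RHS]mulrC -!mulrA.
Qed.

End FormalPowerSeriesTheory.

Theorem theorem2p6 (R : realType) (lambda : R[i]) (hlambda : lambda != 0)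
    (n : nat) :
  deg_cauchy lambda n =
  \sum_(0 <= m < n.+1)
     'C(n, m)%:R * lambda ^+ (n - m) * daehee R[i] (n - m) * deg_cauchy_snd lambda m.
Proof. exact: deg_cauchyE. Qed.
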